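(* Assume that $G:\mathbb{R}\times X\times X\to X$ is continuous, that $p:\mathbb{R}\times X\to X$ is Lipschitz, i.e. there is $L_p\ge0$ with $\|p(t,u)-p(s,v)\|\le L_p(|s-t|+\|u-v\|)$ for all $(t,u),(s,v)\in\mathbb{R}\times X$, and that there are constants $C_1,C_2\ge0$ with $\|p(s,u)\|\le C_1\|u\|+C_2$ for all $(s,u)\in\mathbb{R}\times X$. Assume (A1), (A2), (A3) hold. Then the nonlinear mapping $B:\mathbb{R}\times C\to X$, $B(t,\psi)=G\big(t,\psi(0),F(t,\psi)\big)$, is continuous.
   Context: Let $X$ be a Banach space with norm $\|\cdot\|$, let $r>0$, and let $C=C([-r,0];X)$ be the space of continuous functions $[-r,0]\to X$ with the supremum norm $\|\cdot\|_C$. Let $g:[-r,0]\times\mathbb{R}\times C\to\mathbb{R}$ and $p:\mathbb{R}\times X\to X$, and define the delay functional $F:\mathbb{R}\times C\to X$ by the Stieltjes integral (in $\theta$) $F(t,\psi)=\int_{-r}^0 p(t,\psi(\theta))\,d g(\theta,t,\psi)$. Assumption (A1): for every $(t,\varphi)\in\mathbb{R}\times C$ the function $\theta\mapsto g(\theta,t,\varphi)$ is of bounded variation on $[-r,0]$, and there is $M_{Vg}>0$ such that its total variation $V_{-r}^0 g(\cdot,t,\varphi)\le M_{Vg}$ for all $(t,\varphi)\in\mathbb{R}\times C$. For each $(t,\varphi)$ decompose $g(\cdot,t,\varphi)=g_d(\cdot,t,\varphi)+g_c(\cdot,t,\varphi)$, where $g_d$ is the jump (step-function) part and $g_c=g_{ac}+g_s$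 is the continuous part (sum of the absolutely continuous part and the singular continuous part) of the Lebesgue decomposition of the bounded variation function $g(\cdot,t,\varphi)$. Assumption (A2): for every $\theta\in[-r,0]$, the map $(t,\varphi)\mapsto g_c(\theta,t,\varphi)$ is continuous on $\mathbb{R}\times C$. Assumption (A3): the discontinuity points $\{\theta_k\}\subset[-r,0]$ (finitely or countably many) of $g_d(\cdot,t,\varphi)$ are given by $\theta_k=-\eta_k(t,\varphi)$, with jumps $h_k(t,\varphi)=g_d(\theta_k+0,t,\varphi)-g_d(\theta_k-0,t,\varphi)$, where $\eta_k:\mathbb{R}\times C\to[0,r]$ and $h_k:\mathbb{R}\times C\to\mathbb{R}$ are continuous functions; moreover the series $\sum_k h_k(t,\varphi)$ converges absolutely and uniformly on every bounded subset of $\mathbb{R}\times C$. (Thus $\int_{-r}^0\chi(\theta)\,dg_d(\theta,t,\varphi)=\sum_k\chi(-\eta_k(t,\varphi))h_k(t,\varphi)$.) *)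

(* Defs.v *)
From HB Require Import structures.
From mathcomp Require Import all_boot all_order all_algebra.
From mathcomp Require Import all_classical all_reals all_analysis.
Set Implicit Arguments. Unset Strict Implicit. Unset Printing Implicit Defensive.
Import Order.TTheory GRing.Theory Num.Theory numFieldNormedType.Exports.
Local Open Scope classical_set_scope.
Local Open Scope ring_scope.

(* Elements of C = C([-r,0];X) are represented by functions R -> X that are
   continuous on [-r,0]; only their values on [-r,0] matter. *)
Definition inC {R : realType} {X : normedModType R} (r : R) (psi : R -> X) :=
  {within `[-r, 0], continuous psi}.

Definition distC {R : realType} {X : normedModType R} (r : R) (phi psi : R -> X) : R :=
  sup [set `|phi th - psi th| | th in `[-r, 0]].

Definition normC {R : realType} {X : normedModType R} (r : R) (psi : R -> X) : R :=
  sup [set `|psi th| | th in `[-r, 0]].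

Definition contRC {R : realType} {X V : normedModType R} (r : R)
    (f : R -> (R -> X) -> V) :=
  forall t psi, inC r psi -> forall eps : R, 0 < eps ->
    exists2 del : R, 0 < del & forall s phi, inC r phi ->
      `|s - t| < del -> distC r phi psi < del -> `|f s phi - f t psi| < eps.

Definition RS_sum {R : realType} {X : normedModType R} (n : nat) (x xi : nat -> R)
    (chi : R -> X) (g : R -> R) : X :=
  \sum_(i < n) (g (x i.+1) - g (x i)) *: chi (xi i).

Definition is_RS_integral {R : realType} {X : normedModType R} (a b : R)
    (chi : R -> X) (g : R -> R) (I : X) :=
  forall eps : R, 0 < eps -> exists2 del : R, 0 < del &
    forall (n : nat) (x xi : nat -> R),
      x 0%N = a -> x n = b ->
      (forall i, (i < n)%N -> x i <= xi i <= x i.+1) ->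
      (forall i, (i < n)%N -> x i.+1 - x i < del) ->
      `|RS_sum n x xi chi g - I| < eps.

Definition RS_integral {R : realType} {X : normedModType R} (a b : R)
    (chi : R -> X) (g : R -> R) : X :=
  xget 0 [set I | is_RS_integral a b chi g I].

Definition Fdelay {R : realType} {X : normedModType R} (r : R)
    (p : R -> X -> X) (g : R -> R -> (R -> X) -> R) (t : R) (psi : R -> X) : X :=
  RS_integral (- r) 0 (fun th => p t (psi th)) (fun th => g th t psi).

Definition extr {R : realType} (r : R) (f : R -> R) (th : R) : R :=
  f (Num.min 0 (Num.max (- r) th)).

Definition rlim {R : realType} (f : R -> R) (x : R) : R := lim (f @ x^'+).
Definition llim {R : realType} (f : R -> R) (x : R) : R := lim (f @ x^'-).

Definition jump {R : realType} (r : R) (f : R -> R) (x : R) : R :=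
  rlim (extr r f) x - llim (extr r f) x.

(* sum of an (absolutely summable) real family over a set *)
Definition rsum {R : realType} (S : set R) (u : R -> R) : R :=
  fine (esum S (fun x => (Num.max (u x) 0)%:E))
  - fine (esum S (fun x => (Num.max (- u x) 0)%:E)).

(* jump part g_d (normalized by g_d(-r) = 0):
   g_d(th) = sum_{-r <= x < th} (g(x+0) - g(x-0)) + (g(th) - g(th-0)) *)
Definition jump_part {R : realType} (r : R) (f : R -> R) (th : R) : R :=
  rsum [set x | - r <= x < th] (jump r f) + (extr r f th - llim (extr r f) th).

(* continuous part g_c = g_ac + g_s = g - g_d *)
Definition cont_part {R : realType} (r : R) (f : R -> R) (th : R) : R :=
  f th - jump_part r f th.

(* Main.v *)
Require Import Defs.
From HB Require Import structures.
From mathcomp Require Import all_boot all_order all_algebra.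
From mathcomp Require Import all_classical all_reals all_analysis.
From mathcomp Require Import ring lra.
Set Implicit Arguments. Unset Strict Implicit. Unset Printing Implicit Defensive.
Import Order.TTheory GRing.Theory Num.Theory numFieldNormedType.Exports.
Local Open Scope classical_set_scope.
Local Open Scope ring_scope.

(** For a function [f] of bounded variation with variation function [v], two
    Riemann-Stieltjes sums of mesh at most [d/2] differ by at most [w (v b - v a)],
    where [w] is the oscillation of the integrand at scale [d].  Hence the integral of the
    fixed continuous function [chi = p(t, psi(.))] against [g(., s, phi)] is, uniformly
    in [(s, phi)] near [(t, psi)], close to a Riemann-Stieltjes sum over one fixed
    partition.  Splitting [g = g_c + g_d], the sum for [g_c] involves only finitely
    many values [g_c(x_i, s, phi)], which are continuous by (A2), and the sum for [g_d]
    is uniformly close to [sum_(k < N) h_k chi (- eta_k)], which is continuous by (A3).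
    The identification of the jumps of [g_d] with the atoms [(- eta_k, h_k)] rests on
    the jumps of [g_d] being those of [g], i.e. on the continuity of [g_c].  Replacing
    [chi] by [p(s, phi(.))] costs at most the Lipschitz bound times the variation. *)

(** An abstract majorant stands in for the total variation: only increments of [v] enter the
    estimates, and they telescope. *)
Definition variation_bound {R : realType} (v f : R -> R) :=
  forall s t, s <= t -> `|f t - f s| <= v t - v s.

(** * Comparison of Riemann-Stieltjes sums *)

Section RiemannStieltjesSums.
Context {R : realType} {X : normedModType R}.
Implicit Types (a b d w : R) (f v : R -> R) (chi : R -> X) (x y xi : nat -> R).

Definition tagged_partition a b d n x xi :=
  [/\ x 0%N = a, x n = b, forall i, (i < n)%N -> x i <= xi i <= x i.+1
    & forall i, (i < n)%N -> x i.+1 - x i <= d].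

Lemma tagged_partition_mono a b d n x xi : tagged_partition a b d n x xi ->
  forall i j, (i <= j <= n)%N -> x i <= x j.
Proof.
move=> [_ _ xxi _] i j /andP[+ jn]; elim: j jn => [|j IHj] jn.
  by rewrite leqn0 => /eqP ->.
rewrite leq_eqVlt => /predU1P[->//|]; rewrite ltnS => ij.
have /andP[xj jx] := xxi _ jn.
exact: le_trans (IHj (ltnW jn) ij) (le_trans xj jx).
Qed.

Lemma tagged_partition_bounds a b d n x xi : tagged_partition a b d n x xi ->
  forall i, (i <= n)%N -> a <= x i <= b.
Proof.
move=> P i ni; have m := tagged_partition_mono P; have [x0 xn _ _] := P.
by rewrite -x0 -xn !m ?leqnn ?ni.
Qed.

Lemma tagged_partition_tag a b d n x xi : tagged_partition a b d n x xi ->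
  forall i, (i < n)%N -> a <= xi i <= b.
Proof.
move=> P i ni; have B := tagged_partition_bounds P; have [_ _ xxi _] := P.
have /andP[h1 h2] := xxi _ ni.
have /andP[h3 _] := B _ (ltnW ni); have /andP[_ h4] := B _ ni.
by rewrite (le_trans h3 h1) (le_trans h2 h4).
Qed.

Lemma tagged_partition_variation a b d n x xi v f :
  variation_bound v f -> tagged_partition a b d n x xi ->
  \sum_(i < n) `|f (x i.+1) - f (x i)| <= v b - v a.
Proof.
move=> vf P; have [x0 xn _ _] := P.
rewrite -x0 -xn -(telescope_sumr (fun i => v (x i)) (leq0n n)) big_mkord.
by apply: ler_sum => i _; apply/vf/(tagged_partition_mono P); rewrite leqnSn ltn_ord.
Qed.

Let cell (u : R -> R) (p q s t : R) :=
  (u (Num.min q t) - u (Num.min p t)) - (u (Num.min q s) - u (Num.min p s)).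

Let cellE u p q s t : p <= q -> s <= t ->
  cell u p q s t = if (p < t) && (s < q) then u (Num.min q t) - u (Num.max p s)
                   else 0.
Proof.
move=> pq st; rewrite /cell.
have [pt|tp] := ltP p t => /=; last first.
  have tq := le_trans tp pq; have sp := le_trans st tp; have sq := le_trans st tq.
  by rewrite (min_r tq) (min_r sq) (min_r sp); lra.
have [sq|qs] := ltP s q => /=; last first.
  have qt := le_trans qs st; have ps := le_trans pq qs.
  by rewrite (min_l qt) (min_l ps); lra.
by have [ps|sp] := leP p s; lra.
Qed.

(* Both sums are rewritten over the cells of the common refinement of the two
   partitions; the mixed second difference [cell] of [u (min x_i y_j)] is the
   increment of [u] over the intersection of two subintervals. *)
Lemma RS_sum_dist a b d1 d2 w n x xi m y eta v f chi :
  tagged_partition a b d1 n x xi -> tagged_partition a b d2 m y eta ->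
  variation_bound v f -> 0 <= w ->
  (forall s t, a <= s <= b -> a <= t <= b -> `|s - t| <= d1 + d2 ->
    `|chi s - chi t| <= w) ->
  `|RS_sum n x xi chi f - RS_sum m y eta chi f| <= w * (v b - v a).
Proof.
move=> Px Py vf w0 chiw.
have [x0 xn xxi dx] := Px; have [y0 ym yeta dy] := Py.
(* Summing [cell] over one partition telescopes; truncation at [b] changes nothing and truncation at
   [a] kills everything, which leaves the increment over a cell of the other partition. *)
have row u i : (i < n)%N ->
    \sum_(j < m) cell u (x i) (x i.+1) (y j) (y j.+1) = u (x i.+1) - u (x i).
  move=> ni; have /andP[a1 b1] := tagged_partition_bounds Px ni.
  have /andP[a2 b2] := tagged_partition_bounds Px (ltnW ni).
  have := telescope_sumr (fun j => u (Num.min (x i.+1) (y j)) - u (Num.min (x i) (y j))) (leq0n m).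
  rewrite big_mkord => ->.
  by rewrite ym y0 (min_l b1) (min_l b2) (min_r a1) (min_r a2) subrr subr0.
have col u j : (j < m)%N ->
    \sum_(i < n) cell u (x i) (x i.+1) (y j) (y j.+1) = u (y j.+1) - u (y j).
  move=> nj; have /andP[a1 b1] := tagged_partition_bounds Py nj.
  have /andP[a2 b2] := tagged_partition_bounds Py (ltnW nj).
  have := telescope_sumr (fun i => u (Num.min (x i) (y j.+1)) - u (Num.min (x i) (y j))) (leq0n n).
  rewrite big_mkord xn x0 (min_r b1) (min_r b2) (min_l a1) (min_l a2).
  rewrite subrr subr0 => <-.
  by apply: eq_bigr => i _; rewrite /cell; ring.
have -> : RS_sum n x xi chi f - RS_sum m y eta chi f =
    \sum_(i < n) \sum_(j < m)
      cell f (x i) (x i.+1) (y j) (y j.+1) *: (chi (xi i) - chi (eta j)).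
  transitivity (\sum_(i < n) \sum_(j < m)
      cell f (x i) (x i.+1) (y j) (y j.+1) *: chi (xi i) -
      \sum_(i < n) \sum_(j < m)
      cell f (x i) (x i.+1) (y j) (y j.+1) *: chi (eta j)); last first.
    rewrite -sumrB; apply: eq_bigr => i _; rewrite -sumrB.
    by apply: eq_bigr => j _; rewrite scalerBr.
  congr (_ - _); first by apply: eq_bigr => i _; rewrite -scaler_suml row.
  by rewrite exchange_big; apply: eq_bigr => j _; rewrite -scaler_suml col.
have -> : v b - v a = \sum_(i < n) \sum_(j < m)
    cell v (x i) (x i.+1) (y j) (y j.+1).
  rewrite -x0 -xn -(telescope_sumr (fun i => v (x i)) (leq0n n)) big_mkord.
  by apply: eq_bigr => i _; rewrite row.
rewrite mulr_sumr (le_trans (ler_norm_sum _ _ _))//; apply: ler_sum => i _.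
rewrite mulr_sumr (le_trans (ler_norm_sum _ _ _))//; apply: ler_sum => j _.
have /andP[xi1 xi2] := xxi _ (ltn_ord i).
have /andP[et1 et2] := yeta _ (ltn_ord j).
have xx := le_trans xi1 xi2; have yy := le_trans et1 et2.
have dxi := dx _ (ltn_ord i); have dyj := dy _ (ltn_ord j).
rewrite !cellE//; case: ifPn => [/andP[xy yx]|_]; last first.
  by rewrite scale0r normr0 mulr0.
(* The two cells overlap, so their tags are at most [d1 + d2] apart. *)
rewrite normrZ mulrC ler_pM//.
  apply: chiw; [exact: (tagged_partition_tag Px)|exact: (tagged_partition_tag Py)|].
  by rewrite ler_norml; lra.
by apply: vf; rewrite le_min !ge_max xx yy !(ltW xy, ltW yx).
Qed.

Definition uniform_point a b (n i : nat) : R := a + i%:R * ((b - a) / n%:R).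

Lemma uniform_partition a b d n : a <= b -> (0 < n)%N -> (b - a) / n%:R <= d ->
  tagged_partition a b d n (uniform_point a b n) (uniform_point a b n).
Proof.
move=> ab n0 nd; rewrite /uniform_point; split.
- by rewrite mul0r addr0.
- by rewrite mulrC divfK ?pnatr_eq0 ?lt0n_neq0// subrKC.
- move=> i _; rewrite lexx lerD2l ler_wpM2r ?ler_nat//.
  by rewrite divr_ge0// subr_ge0.
- by move=> i _; rewrite -natr1; lra.
Qed.

Lemma uniform_mesh_lt a b d : 0 < d ->
  \forall n \near \oo, (b - a) / n.+1%:R < d.
Proof.
move=> d0; near=> n.
rewrite ltr_pdivrMr ?ltr0n// -ltr_pdivrMl//.
near: n; exists (Num.trunc (Num.max 0 (d^-1 * (b - a)))) => // n /= tn.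
apply: (@le_lt_trans _ _ (Num.max 0 (d^-1 * (b - a)))).
  by rewrite le_max lexx orbT.
apply: lt_le_trans (truncnS_gt _) _.
by rewrite ler_nat ltnS.
Unshelve. all: by end_near. Qed.

Definition unif_cont_on a b chi := forall w, 0 < w -> exists2 d : R, 0 < d &
  forall s t, a <= s <= b -> a <= t <= b -> `|s - t| <= d ->
    `|chi s - chi t| <= w.

End RiemannStieltjesSums.

(** * Existence and approximation of the Riemann-Stieltjes integral *)

Section RiemannStieltjesIntegral.
Context {R : realType} {X : completeNormedModType R}.
Implicit Types (a b d w : R) (f v : R -> R) (chi : R -> X).

(** Index [n] stands for [n.+1] equal cells tagged at their left ends, so the mesh never divides by
    zero. *)
Definition uniform_sum a b n chi f :=
  RS_sum n.+1 (uniform_point a b n.+1) (uniform_point a b n.+1) chi f.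

(** The uniform sums are Cauchy in the complete space [X], and every fine tagged sum is close to a
    fine uniform one. Existence ensures that [xget] picks an integral and not its default 0. *)
Lemma RS_integral_exists a b chi f v : a <= b -> unif_cont_on a b chi ->
  variation_bound v f -> is_RS_integral a b chi f (RS_integral a b chi f).
Proof.
move=> ab uc vf; apply: xgetPex.
have vab : 0 <= v b - v a by apply: le_trans (vf _ _ ab).
pose V := v b - v a + 1; have V0 : 0 < V by rewrite /V ltr_wpDl.
have osc e : 0 < e -> exists2 d, 0 < d & forall d1 d2 n x xi m y eta,
    d1 + d2 <= d ->
    tagged_partition a b d1 n x xi -> tagged_partition a b d2 m y eta ->
    `|RS_sum n x xi chi f - RS_sum m y eta chi f| < e.
  move=> e0; have [d d0 dchi] := uc _ (divr_gt0 e0 V0); exists d => // d1 d2.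
  move=> n x xi m y eta dd Px Py.
  have w0 : 0 <= e / V by rewrite divr_ge0// ltW.
  apply: (le_lt_trans (RS_sum_dist (w := e / V) Px Py vf w0 _)).
    by move=> s t sab tab st; apply: dchi => //; exact: le_trans dd.
  rewrite -/V mulrAC ltr_pdivrMr// ltr_pM2l// /V ltrDl //.
have cvgu : cvg ((fun n => uniform_sum a b n chi f) @ \oo).
  apply/cauchy_cvgP/cauchy_exP => e e0.
  have [d d0 dd] := osc _ e0.
  have d20 : 0 < d / 2 by rewrite divr_gt0.
  have [N _ HN] := uniform_mesh_lt a b d20.
  exists (uniform_sum a b N chi f); exists N => // n /= Nn.
  rewrite /= -ball_normE /=; apply: (dd (d / 2) (d / 2)); first by lra.
    by apply: uniform_partition => //; apply/ltW/HN => /=.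
  by apply: uniform_partition => //; apply/ltW/HN => /=.
exists (lim ((fun n => uniform_sum a b n chi f) @ \oo)) => e e0.
have e20 : 0 < e / 2 by rewrite divr_gt0.
have [d d0 dd] := osc _ e20.
have d20 : 0 < d / 2 by rewrite divr_gt0.
exists (d / 2) => // n x xi x0 xn xxi xd.
have /cvgrPdist_lt/(_ _ e20) near1 := cvgu.
near \oo => N.
have Px : tagged_partition a b (d / 2) n x xi.
  by split=> // i ni; exact/ltW/xd.
have N1 : `|lim ((fun n => uniform_sum a b n chi f) @ \oo) -
    uniform_sum a b N chi f| < e / 2 by near: N.
have PN : tagged_partition a b (d / 2) N.+1 (uniform_point a b N.+1)
    (uniform_point a b N.+1).
  apply: uniform_partition => //; apply/ltW; near: N; exact: uniform_mesh_lt.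
have dd2 : d / 2 + d / 2 <= d by lra.
have N2 := dd _ _ _ _ _ _ _ _ dd2 Px PN.
rewrite distrC in N1.
by rewrite (splitr e) (le_lt_trans (ler_distD (uniform_sum a b N chi f) _ _))// ltrD.
Unshelve. all: by end_near. Qed.

Lemma uniform_sum_cvg a b chi f v : a <= b -> unif_cont_on a b chi ->
  variation_bound v f -> uniform_sum a b n chi f @[n --> \oo] --> RS_integral a b chi f.
Proof.
move=> ab uc vf; apply/cvgrPdist_lt => e e0.
have [d d0 dI] := RS_integral_exists ab uc vf e0.
near=> n; rewrite distrC; apply: dI.
- by rewrite /uniform_point mul0r addr0.
- by rewrite /uniform_point mulrC divfK ?pnatr_eq0// subrKC.
- by move=> i _; rewrite lexx lerD2l ler_wpM2r ?ler_nat// divr_ge0// subr_ge0.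
- move=> i _; rewrite /uniform_point -natr1 mulrDl mul1r opprD addrACA subrr add0r.
  by rewrite addrAC subrr add0r; near: n; exact: uniform_mesh_lt.
Unshelve. all: by end_near. Qed.

(** Limit of the comparison of two uniform sums of mesh at most [d / 2]. The bound sees [f] only
    through [v], hence is uniform over integrators of commonly bounded variation. *)
Lemma RS_integral_uniform_sum a b d w n chi f v : a <= b -> unif_cont_on a b chi ->
  variation_bound v f -> 0 < d -> 0 <= w ->
  (forall s t, a <= s <= b -> a <= t <= b -> `|s - t| <= d ->
    `|chi s - chi t| <= w) ->
  (b - a) / n.+1%:R <= d / 2 ->
  `|RS_integral a b chi f - uniform_sum a b n chi f| <= w * (v b - v a).
Proof.
move=> ab uc vf d0 w0 dw nd.
have c := uniform_sum_cvg ab uc vf.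
have {}c : `|uniform_sum a b m chi f - uniform_sum a b n chi f| @[m --> \oo] -->
   `|RS_integral a b chi f - uniform_sum a b n chi f|.
  exact: cvg_norm (cvgB c (cvg_cst _)).
apply: cvgr_to_le c _.
near=> m; apply: (@RS_sum_dist _ _ a b (d / 2) (d / 2)) => //.
- apply: uniform_partition => //; apply/ltW; near: m.
  by apply: uniform_mesh_lt; rewrite divr_gt0.
- exact: uniform_partition.
- by move=> s t sab tab st; apply: dw => //; apply: le_trans st _; lra.
Unshelve. all: by end_near. Qed.

Lemma RS_integral_dist a b w chi1 chi2 f v : a <= b -> unif_cont_on a b chi1 ->
  unif_cont_on a b chi2 -> variation_bound v f -> 0 <= w ->
  (forall s, a <= s <= b -> `|chi1 s - chi2 s| <= w) ->
  `|RS_integral a b chi1 f - RS_integral a b chi2 f| <= w * (v b - v a).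
Proof.
move=> ab uc1 uc2 vf w0 dw.
have c1 := uniform_sum_cvg ab uc1 vf; have c2 := uniform_sum_cvg ab uc2 vf.
have c : `|uniform_sum a b n chi1 f - uniform_sum a b n chi2 f| @[n --> \oo] -->
  `|RS_integral a b chi1 f - RS_integral a b chi2 f|.
  exact: cvg_norm (cvgB c1 c2).
apply: (cvgr_to_le c).
apply: nearW => m /=; rewrite /uniform_sum /RS_sum -sumrB.
have P := uniform_partition ab (ltn0Sn m) (lexx _).
apply: le_trans (ler_norm_sum _ _ _) _.
apply: (@le_trans _ _ (w * \sum_(i < m.+1)
  `|f (uniform_point a b m.+1 i.+1) - f (uniform_point a b m.+1 i)|)); last first.
  by rewrite ler_wpM2l//; exact: tagged_partition_variation vf P.
rewrite mulr_sumr; apply: ler_sum => i _; rewrite -scalerBr normrZ mulrC.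
by rewrite ler_wpM2r//; apply/dw/(tagged_partition_tag P).
Qed.

End RiemannStieltjesIntegral.

(** * One-sided limits and jumps under a variation bound *)

Section OneSidedLimits.
Context {R : realType}.
Implicit Types (f v u : R -> R) (a b c s t x y : R).

Lemma variation_bound_homo v f : variation_bound v f -> {homo v : s t / s <= t}.
Proof. by move=> vf s t st; rewrite -subr_ge0 (le_trans _ (vf _ _ st)). Qed.

Lemma variation_bound_refl v f : variation_bound v f -> variation_bound v v.
Proof.
move=> vf s t st; rewrite ger0_norm// subr_ge0.
exact: variation_bound_homo vf _ _ st.
Qed.

Lemma rlim_eq f x l : f @ x^'+ --> l -> rlim f x = l.
Proof. by move=> fl; apply/cvg_lim. Qed.

Lemma llim_eq f x l : f @ x^'- --> l -> llim f x = l.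
Proof. by move=> fl; apply/cvg_lim. Qed.

Let homo_rlim u x : {homo u : s t / s <= t} -> u @ x^'+ --> rlim u x.
Proof.
move=> nd; apply: nondecreasing_at_right_is_cvgr; apply: nearW => y.
  by move=> s t _ _; exact: nd.
exists (u x) => _ [s /= + <-]; rewrite in_itv/= => /andP[xs _].
exact/nd/ltW.
Qed.

Let homo_llim u x : {homo u : s t / s <= t} -> u @ x^'- --> llim u x.
Proof.
move=> nd; apply: nondecreasing_at_left_is_cvgr; apply: nearW => y.
  by move=> s t _ _; exact: nd.
exists (u x) => _ [s /= + <-]; rewrite in_itv/= => /andP[_ sx].
exact/nd/ltW.
Qed.

Let homo_add v f : variation_bound v f -> {homo (f \+ v) : s t / s <= t}.
Proof. by move=> vf s t /vf; rewrite ler_norml/= => /andP[+ _]; lra. Qed.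

(** Jordan decomposition: [f] is the difference of the nondecreasing functions [f \+ v] and [v],
    which have one-sided limits. *)
Lemma cvg_rlim v f x : variation_bound v f -> f @ x^'+ --> rlim f x.
Proof.
move=> vf; have vnd := variation_bound_homo vf.
have fl : ((f \+ v) \- v) @ x^'+ --> rlim (f \+ v) x - rlim v x.
  by apply: cvgB; apply: homo_rlim => //; exact: homo_add.
have E : (f \+ v) \- v = f by apply/funext => s /=; rewrite addrK.
by rewrite E in fl; rewrite (rlim_eq fl).
Qed.

Lemma cvg_llim v f x : variation_bound v f -> f @ x^'- --> llim f x.
Proof.
move=> vf; have vnd := variation_bound_homo vf.
have fl : ((f \+ v) \- v) @ x^'- --> llim (f \+ v) x - llim v x.
  by apply: cvgB; apply: homo_llim => //; exact: homo_add.
have E : (f \+ v) \- v = f by apply/funext => s /=; rewrite addrK.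
by rewrite E in fl; rewrite (llim_eq fl).
Qed.

(** Like the next four bounds, obtained by letting one point tend to [x] from one side, in
    [variation_bound] or in a bound already so obtained. *)
Lemma rlim_dist_gt v f x t : variation_bound v f -> x < t ->
  `|f t - rlim f x| <= v t - rlim v x.
Proof.
move=> vf xt; have vv := variation_bound_refl vf.
apply: (@ler_cvg_to _ x^'+ _ _ (fun s => `|f t - f s|) (fun s => v t - v s)).
- exact: cvg_norm (cvgB (cvg_cst _) (cvg_rlim vf)).
- exact: cvgB (cvg_cst _) (cvg_rlim vv).
- by near=> s; apply/vf/ltW; near: s; exact: nbhs_right_lt.
Unshelve. all: by end_near. Qed.

Lemma rlim_dist_le v f x s : variation_bound v f -> s <= x ->
  `|rlim f x - f s| <= rlim v x - v s.
Proof.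
move=> vf sx; have vv := variation_bound_refl vf.
apply: (@ler_cvg_to _ x^'+ _ _ (fun t => `|f t - f s|) (fun t => v t - v s)).
- exact: cvg_norm (cvgB (cvg_rlim vf) (cvg_cst _)).
- exact: cvgB (cvg_rlim vv) (cvg_cst _).
- near=> t; apply/vf/(le_trans sx)/ltW; near: t; exact: nbhs_right_gt.
Unshelve. all: by end_near. Qed.

Lemma llim_dist_lt v f x s : variation_bound v f -> s < x ->
  `|llim f x - f s| <= llim v x - v s.
Proof.
move=> vf sx; have vv := variation_bound_refl vf.
apply: (@ler_cvg_to _ x^'- _ _ (fun t => `|f t - f s|) (fun t => v t - v s)).
- exact: cvg_norm (cvgB (cvg_llim vf) (cvg_cst _)).
- exact: cvgB (cvg_llim vv) (cvg_cst _).
- by near=> t; apply/vf/ltW; near: t; exact: nbhs_left_gt.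
Unshelve. all: by end_near. Qed.

Lemma llim_dist v f x : variation_bound v f -> `|f x - llim f x| <= v x - llim v x.
Proof.
move=> vf; have vv := variation_bound_refl vf.
apply: (@ler_cvg_to _ x^'- _ _ (fun t => `|f x - f t|) (fun t => v x - v t)).
- exact: cvg_norm (cvgB (cvg_cst _) (cvg_llim vf)).
- exact: cvgB (cvg_cst _) (cvg_llim vv).
- by near=> t; apply/vf/ltW; near: t; exact: nbhs_left_lt.
Unshelve. all: by end_near. Qed.

Lemma jump_dist v f x : variation_bound v f ->
  `|rlim f x - llim f x| <= rlim v x - llim v x.
Proof.
move=> vf; have vv := variation_bound_refl vf.
apply: (@ler_cvg_to _ x^'- _ _ (fun t => `|rlim f x - f t|)
  (fun t => rlim v x - v t)).
- exact: cvg_norm (cvgB (cvg_cst _) (cvg_llim vf)).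
- exact: cvgB (cvg_cst _) (cvg_llim vv).
- near=> t; apply: rlim_dist_le => //; apply/ltW; near: t; exact: nbhs_left_lt.
Unshelve. all: by end_near. Qed.

Lemma rlim_le_llim v x y : variation_bound v v -> x < y -> rlim v x <= llim v y.
Proof.
move=> vv xy; have [xm my] := midf_lt xy.
have := rlim_dist_gt vv xm; have := llim_dist_lt vv my.
by move=> /(le_trans (normr_ge0 _)) + /(le_trans (normr_ge0 _)); lra.
Qed.

(** Induction along the increasing list: each jump of [f] is at most that of [v], and [v] does not
    decrease between consecutive points. *)
Lemma sum_jump_le v f a b (s : seq R) : variation_bound v f -> a < b ->
  path <%R a s -> all (fun y => y < b) s ->
  \sum_(y <- s) `|rlim f y - llim f y| <= llim v b - rlim v a.
Proof.
move=> vf; have vv := variation_bound_refl vf.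
elim: s a => [|y s IHs] a ab /=.
  by move=> _ _; rewrite big_nil subr_ge0; exact: rlim_le_llim.
move=> /andP[ay pys] /andP[yb sb]; rewrite big_cons.
have := IHs _ yb pys sb; have := jump_dist y vf; have := rlim_le_llim vv ay; lra.
Qed.

(** The unordered sum is a supremum over finite subsets, and each of these can be sorted. *)
Lemma esum_jump_le v f a b (A : set R) : variation_bound v f -> a < b ->
  A `<=` [set y | a < y < b] ->
  (\esum_(y in A) `|rlim f y - llim f y|%:E <= (llim v b - rlim v a)%:E)%E.
Proof.
move=> vf ab Aab; apply: ge_ereal_sup => _ [F [finF FA] <-].
rewrite fsbig_finite//= sumEFin lee_fin.
set s := finmap.enum_fset _.
have ss : perm_eq s (sort <=%R s) by rewrite perm_sym perm_sort.
have sab y : y \in sort <=%R s -> a < y < b.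
  by rewrite mem_sort in_fset_set// inE => /FA/Aab.
rewrite (perm_big _ ss)/=; apply: sum_jump_le => //.
  rewrite path_sortedE; last exact: lt_trans.
  apply/andP; split; first by apply/allP => y /sab /andP[].
  by rewrite lt_sorted_uniq_le sort_uniq finmap.fset_uniq sort_sorted//; exact: le_total.
by apply/allP => y /sab /andP[].
Qed.

End OneSidedLimits.

(** * Signed sums over sets of points *)

Section SignedSums.
Context {R : realType}.
Implicit Types (A B : set R) (u : R -> R) (x c : R).
Local Open Scope ereal_scope.

Let pos_ge0 (y : R) : 0 <= (Num.max y 0)%:E.
Proof. by rewrite lee_fin le_max lexx orbT. Qed.

Let pos_abs (y : R) : (Num.max y 0)%:E <= `|y|%:E.
Proof. by rewrite lee_fin ge_max ler_norm normr_ge0. Qed.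

Let neg_abs (y : R) : (Num.max (- y) 0)%:E <= `|y|%:E.
Proof. by rewrite lee_fin ge_max -normrN ler_norm normr_ge0. Qed.

(** The positive and the negative sum both lie between 0 and [c]. Their finiteness matters because
    [fine] sends infinite values to 0. *)
Lemma rsum_abs_le A u c : \esum_(y in A) `|u y|%:E <= c%:E ->
  (`|rsum A u| <= c)%R.
Proof.
move=> uc; rewrite /rsum.
have P0 := @esum_ge0 _ _ A _ (fun x _ => pos_ge0 (u x)).
have N0 := @esum_ge0 _ _ A _ (fun x _ => pos_ge0 (- u x)%R).
have Pc := le_trans (@le_esum _ _ A _ _ (fun x _ => pos_abs (u x))) uc.
have Nc := le_trans (@le_esum _ _ A _ _ (fun x _ => neg_abs (u x))) uc.
move: (esum _ _) P0 Pc => [p| |]//=; move: (esum _ _) N0 Nc => [n| |]//=.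
by rewrite !lee_fin => n0 nc p0 pc; rewrite ler_norml; lra.
Qed.

Lemma rsumID A B u : summable A (EFin \o u) ->
  rsum A u = (rsum (A `&` B) u + rsum (A `&` ~` B) u)%R.
Proof.
move=> Au; rewrite /rsum.
rewrite (@esumID _ _ B A (fun x => (Num.max (u x) 0)%:E))//.
rewrite (@esumID _ _ B A (fun x => (Num.max (- u x) 0)%:E))//.
have fin C w : C `<=` A -> (forall y, (w y)%:E <= `|u y|%:E) ->
    (forall y, 0 <= (w y)%:E) -> \esum_(y in C) (w y)%:E \is a fin_num.
  move=> CA wu w0; rewrite ge0_fin_numE; last by apply: esum_ge0.
  apply: le_lt_trans Au; rewrite [leRHS](@esumID _ _ C A)//.
  have -> : A `&` C = C by rewrite setIC; apply/setIidPl.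
  by rewrite (le_trans (le_esum (fun y _ => wu y)))// leeDl// esum_ge0.
rewrite !fineD ?fin//; try exact: subIsetl.
lra.
Qed.

Lemma rsum_set1 u x : rsum [set x] u = u x.
Proof.
rewrite /rsum !esum_set1//=.
by have [u0|u0] := leP (u x) 0%R; [rewrite max_l ?max_r|rewrite max_r]; lra.
Qed.

End SignedSums.

(** * The jumps of the jump part *)

Section JumpPart.
Context {R : realType}.
Implicit Types (f v : R -> R) (r x y : R).

Lemma extr_id r f x : - r <= x <= 0 -> extr r f x = f x.
Proof. by move=> /andP[rx x0]; rewrite /extr max_r// min_r. Qed.

Lemma extr_ge0 r f x : 0 <= r -> 0 <= x -> extr r f x = f 0.
Proof.
by move=> r0 x0; rewrite /extr max_r ?min_l// (le_trans _ x0)// oppr_le0.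
Qed.

Lemma extr_leN r f x : 0 <= r -> x <= - r -> extr r f x = f (- r).
Proof.
by move=> r0 xr; rewrite /extr max_l// min_r// oppr_le0.
Qed.

Lemma jump_summable r f v (A : set R) : 0 <= r -> variation_bound v (extr r f) ->
  A `<=` [set y | - r <= y <= 0] -> summable A (EFin \o jump r f).
Proof.
(* The bound on jumps concerns an open interval, so the segment is enlarged to include the jumps at
   [- r] and 0. *)
move=> r0 vf Ar; have ab : - r - 1 < 1 by lra.
apply: le_lt_trans (ltry _); apply: (esum_jump_le vf ab).
by move=> y /Ar /= /andP[ry y0]; apply/andP; split; lra.
Qed.

(** For [t > x] the jumps strictly between [x] and [t] and the left jump at [t] add up to at most
    [v t - rlim v x], which tends to 0. *)
Lemma rlim_jump_part r f v x : 0 < r -> variation_bound v (extr r f) ->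
  - r <= x <= 0 ->
  rlim (extr r (jump_part r f)) x = rsum [set y | - r <= y <= x] (jump r f).
Proof.
move=> r0 vf /andP[rx x0]; have vv := variation_bound_refl vf.
apply: rlim_eq; move: x0; rewrite le_eqVlt => /predU1P[xE|x0].
  (* The extension is constant to the right of 0, so the right limit is the value at 0, and the left
     jump at 0 is the whole jump there. *)
  rewrite xE; apply: cvg_near_cst; near=> t.
  have t0 : 0 < t by near: t; exact: nbhs_right_gt.
  rewrite extr_ge0 ?(ltW r0) ?(ltW t0)//.
  rewrite [RHS](@rsumID _ _ [set y | y < 0]); last first.
    by apply: (jump_summable (ltW r0) vf).
  rewrite /jump_part; congr (rsum _ _ + _).
    by apply/seteqP; split=> y /=; [move=> /andP[-> /[dup] /ltW -> ->]|
      move=> [/andP[-> _] ->]].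
  rewrite (_ : _ `&` _ = [set 0]); last first.
    apply/seteqP; split=> y /=.
      by move=> [/andP[_ y0] /negP]; rewrite -leNgt => y0'; apply/eqP; rewrite eq_le y0.
    by move=> ->; rewrite ltxx lexx oppr_le0 ltW.
  rewrite rsum_set1 /jump; congr (_ - _).
  rewrite (@rlim_eq _ _ _ (extr r f 0))//; apply: cvg_near_cst; near=> s.
  have s0 : 0 < s by near: s; exact: nbhs_right_gt.
  by rewrite !extr_ge0// ltW.
apply/cvgrPdist_lt => e e0.
have /cvgrPdist_lt/(_ _ e0) ve := cvg_rlim (x := x) vv.
near=> t.
have xt : x < t by near: t; exact: nbhs_right_gt.
have t0 : t <= 0 by near: t; exact: nbhs_right_le.
have vt : `|rlim v x - v t| < e by near: t.
rewrite extr_id; last by rewrite (le_trans rx (ltW xt)).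
rewrite distrC /jump_part (@rsumID _ _ [set y | y <= x]); last first.
  apply: (jump_summable (ltW r0) vf) => y /= /andP[-> yt].
  by rewrite (le_trans (ltW yt)).
have -> : [set y | - r <= y < t] `&` [set y | y <= x] = [set y | - r <= y <= x].
  apply/seteqP; split=> y /=; first by move=> [/andP[-> _] ->].
  by move=> /andP[-> yx]; rewrite yx (le_lt_trans yx xt).
set A := _ `&` _.
have h1 : `|rsum A (jump r f)| <= llim v t - rlim v x.
  apply/rsum_abs_le/(esum_jump_le vf xt) => y [/= /andP[_ yt] /negP].
  by rewrite -ltNge => ->.
have h2 := llim_dist t vf.
rewrite [X in `|X| < _](_ : _ =
  rsum A (jump r f) + (extr r f t - llim (extr r f) t)); last by ring.
rewrite (le_lt_trans (ler_normD _ _))//.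
by move: vt; rewrite ltr_norml; lra.
Unshelve. all: by end_near. Qed.

Lemma llim_jump_part r f v x : 0 < r -> variation_bound v (extr r f) ->
  - r <= x <= 0 ->
  llim (extr r (jump_part r f)) x = rsum [set y | - r <= y < x] (jump r f).
Proof.
move=> r0 vf /andP[rx x0]; have vv := variation_bound_refl vf.
have r0' := ltW r0.
apply: llim_eq; move: rx; rewrite le_eqVlt => /predU1P[xE|rx].
  rewrite -xE; apply: cvg_near_cst; near=> t.
  have tr : t < - r by near: t; exact: nbhs_left_lt.
  rewrite extr_leN ?(ltW tr)// /jump_part (@llim_eq _ _ _ (extr r f (- r))).
    by rewrite subrr addr0.
  apply: cvg_near_cst; near=> s.
  have sr : s < - r by near: s; exact: nbhs_left_lt.
  by rewrite !extr_leN// ltW.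
apply/cvgrPdist_lt => e e0; have e20 : 0 < e / 2 by rewrite divr_gt0.
have /cvgrPdist_lt/(_ _ e20) ve := cvg_llim (x := x) vv.
(* With [c] fixed before [t], the jumps from [t] up to [x] and the left jump at [t] are each bounded
   by the increase of [v] between [c] and [x]; hence [e / 2]. *)
near x^'- => c.
have vc : `|llim v x - v c| < e / 2 by near: c.
have cx : c < x by near: c; exact: nbhs_left_lt.
near=> t.
have ct : c < t by near: t; exact: nbhs_left_gt.
have tx : t < x by near: t; exact: nbhs_left_lt.
have rt : - r <= t by near: t; exact: nbhs_left_ge.
rewrite extr_id; last by rewrite rt (le_trans (ltW tx)).
rewrite /jump_part (@rsumID _ [set y | - r <= y < x] [set y | y < t]); last first.
  apply: (jump_summable r0' vf) => y /= /andP[-> yt].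
  by rewrite (le_trans (ltW yt)).
have -> : [set y | - r <= y < x] `&` [set y | y < t] = [set y | - r <= y < t].
  apply/seteqP; split=> y /=; first by move=> [/andP[-> _] ->].
  by move=> /andP[-> yt]; rewrite yt (lt_trans yt tx).
set A := _ `&` _.
have h1 : `|rsum A (jump r f)| <= llim v x - rlim v c.
  apply/rsum_abs_le/(esum_jump_le vf cx) => y [/= /andP[_ yx] /negP].
  by rewrite -leNgt => ty; rewrite yx (lt_le_trans ct ty).
have h2 := llim_dist t vf.
have h3 := rlim_le_llim vv ct.
have := rlim_dist_le vv (lexx c) => /(le_trans (normr_ge0 _)) h4.
have := llim_dist_lt vv tx => /(le_trans (normr_ge0 _)) h5.
rewrite [X in `|X| < _](_ : _ =
  rsum A (jump r f) - (extr r f t - llim (extr r f) t)); last by ring.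
rewrite (le_lt_trans (ler_normB _ _))//.
by move: vc; rewrite ltr_norml; lra.
Unshelve. all: by end_near. Qed.

(** The two one-sided limits are sums over sets that differ by the point [x] alone. This turns (A3),
    which speaks of the jumps of [g_d], into information on the jumps of [g]. *)
Lemma jump_jump_part r f v x : 0 < r -> variation_bound v (extr r f) ->
  - r <= x <= 0 -> jump r (jump_part r f) x = jump r f x.
Proof.
move=> r0 vf rx0; have /andP[rx x0] := rx0.
rewrite [LHS]/jump (rlim_jump_part r0 vf rx0) (llim_jump_part r0 vf rx0).
rewrite (@rsumID _ _ [set y | y < x]); last first.
  apply: (jump_summable (ltW r0) vf) => y /= /andP[-> yx].
  exact: le_trans yx x0.
have -> : [set y | - r <= y <= x] `&` [set y | y < x] = [set y | - r <= y < x].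
  apply/seteqP; split=> y /=; first by move=> [/andP[-> _] ->].
  by move=> /andP[-> yx]; rewrite yx (ltW yx).
have -> : [set y | - r <= y <= x] `&` ~` [set y | y < x] = [set x].
  apply/seteqP; split=> y /=.
    by move=> [/andP[_ y0] /negP]; rewrite -leNgt => y0'; apply/eqP; rewrite eq_le y0.
  by move=> ->; rewrite ltxx lexx rx.
by rewrite rsum_set1 addrAC subrr add0r.
Qed.

End JumpPart.

(** * From series of atoms to sums over points *)

Section Atoms.
Context {R : realType}.
Implicit Types (w h c : nat -> R) (A : set R) (J : R -> R) (B : pred nat).

Let cvg_sum_pred B w : (forall k, 0 <= w k) ->
  summable [set: nat] (EFin \o w) ->
  summable [set` B] (EFin \o w) /\
  (\sum_(0 <= k < n | B k) w k @[n --> \oo] -->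
  fine (\esum_(k in [set` B]) (w k)%:E)).
Proof.
move=> w0 sw.
have sB : summable [set` B] (EFin \o w).
  apply: le_lt_trans sw; rewrite [leRHS](@esumID _ _ [set` B])// setTI.
  by rewrite leeDl// esum_ge0.
split=> //.
have w0' k : B k -> (0 <= (w k)%:E)%E by rewrite lee_fin.
have := summable_cvg w0' sB.
have := summable_nneseries_lim w0' sB.
by rewrite nneseries_esum// => ->.
Qed.

Lemma cvg_sum_signed B h (H : R) : (forall n, \sum_(0 <= k < n) `|h k| <= H) ->
  let p := \esum_(k in [set` B]) (Num.max (h k) 0)%:E in
  let m := \esum_(k in [set` B]) (Num.max (- h k) 0)%:E in
  [/\ p \is a fin_num, m \is a fin_num &
   \sum_(0 <= k < n | B k) h k @[n --> \oo] --> fine p - fine m].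
Proof.
move=> hH p m.
have sh : summable [set: nat] (EFin \o h).
  apply: le_lt_trans (ltry H); rewrite -nneseries_esumT//.
  apply: lime_le; first exact: is_cvg_nneseries.
  by apply: nearW => n; rewrite sumEFin lee_fin.
have sle w : (forall k, 0 <= w k <= `|h k|) -> summable [set: nat] (EFin \o w).
  move=> wh; apply: le_lt_trans sh; apply: le_esum => k _ /=.
  by have /andP[w0 wk] := wh k; rewrite lee_fin ger0_norm.
have hp k : 0 <= Num.max (h k) 0 <= `|h k|.
  by rewrite le_max lexx orbT ge_max ler_norm normr_ge0.
have hm k : 0 <= Num.max (- h k) 0 <= `|h k|.
  by rewrite le_max lexx orbT ge_max -normrN ler_norm normr_ge0.
have [sp cp] := @cvg_sum_pred B _ (fun k => proj1 (andP (hp k))) (sle _ hp).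
have [sm cm] := @cvg_sum_pred B _ (fun k => proj1 (andP (hm k))) (sle _ hm).
have fin w : (forall k, 0 <= w k <= `|h k|) -> summable [set` B] (EFin \o w) ->
    \esum_(k in [set` B]) (w k)%:E \is a fin_num.
  move=> wh; rewrite summableE; congr (_ \is a fin_num).
  by apply: eq_esum => k _ /=; have /andP[w0 _] := wh k; rewrite ger0_norm.
split; [exact: (fin _ hp)|exact: (fin _ hm)|].
have E : (fun n => \sum_(0 <= k < n | B k) h k) =
  (fun n => \sum_(0 <= k < n | B k) Num.max (h k) 0 -
            \sum_(0 <= k < n | B k) Num.max (- h k) 0).
  apply/funext => n; rewrite -sumrB; apply: eq_bigr => k _.
  by have [u0|u0] := leP (h k) 0; [rewrite max_l|rewrite max_r]; lra.
by rewrite E; exact: cvgB cp cm.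
Qed.

(** Several indices may carry the same point, so the series is regrouped along the fibres of [c], as
    absolute convergence permits. *)
Lemma rsum_atoms A c h J (H : R) : (forall n, \sum_(0 <= k < n) `|h k| <= H) ->
  (forall x, A x ->
    J x = limn (fun n => \sum_(0 <= k < n) (if c k == x then h k else 0))) ->
  \sum_(0 <= k < n) (if c k \in A then h k else 0) @[n --> \oo] --> rsum A J.
Proof.
move=> hH JE.
pose p x := \esum_(k in [set k | c k == x]) (Num.max (h k) 0)%:E.
pose m x := \esum_(k in [set k | c k == x]) (Num.max (- h k) 0)%:E.
have pm x := cvg_sum_signed (fun k => c k == x) hH.
have [finp finm cA] := cvg_sum_signed (fun k => c k \in A) hH.
have esumE w : (forall k, 0 <= w k) ->
    \esum_(x in A) \esum_(k in [set k | c k == x]) (w k)%:E =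
    \esum_(k in [set k | c k \in A]) (w k)%:E.
  move=> w0; rewrite esum_esum; last by move=> *; rewrite lee_fin.
  apply: (@reindex_esum _ _ _ [set k | c k \in A] _ (fun k => (c k, k))
    (fun k => (w k.2)%:E)); split.
  - by move=> k /=; rewrite inE => Ak; split=> /=.
  - by move=> k l _ _ [].
  - move=> [x k] /= [/= Ax /eqP cx]; exists k; rewrite /= ?cx//; exact/mem_set.
have p0 x : (0 <= p x)%E.
  by apply: esum_ge0 => k _; rewrite lee_fin le_max lexx orbT.
have m0 x : (0 <= m x)%E.
  by apply: esum_ge0 => k _; rewrite lee_fin le_max lexx orbT.
have pE : \esum_(x in A) p x = \esum_(k in [set k | c k \in A]) (Num.max (h k) 0)%:E.
  by apply: esumE => k; rewrite le_max lexx orbT.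
have mE : \esum_(x in A) m x = \esum_(k in [set k | c k \in A]) (Num.max (- h k) 0)%:E.
  by apply: esumE => k; rewrite le_max lexx orbT.
have sumof (q : R -> \bar R) : (forall x, 0 <= q x)%E -> \esum_(x in A) q x \is a fin_num -> summable A q.
  move=> q0; rewrite summableE; congr (_ \is a fin_num); apply: eq_esum => x _.
  by rewrite gee0_abs.
have sp : summable A p by apply: sumof => //; rewrite pE.
have sm : summable A m by apply: sumof => //; rewrite mE.
have JpmE x : A x -> (J x)%:E = (p \- m)%E x.
  move=> Ax; have [fp fm cx] := pm x; rewrite /= -[p x]fineK// -[m x]fineK// -EFinB.
  congr EFin; rewrite JE//; apply/cvg_lim => //.
  by under eq_fun do rewrite -big_mkcond/=.
(* Atoms at one point may cancel, so [p] and [m] need not be the positive and negative parts of [J];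
   only their difference is [J] on [A]. *)
have := esumB sp sm (fun x _ => p0 x) (fun x _ => m0 x).
have posE : \esum_(x in A) (p \- m)^\+%E x = \esum_(x in A) (Num.max (J x) 0)%:E.
  by apply: eq_esum => x Ax; rewrite funeposE -JpmE// EFin_max.
have negE : \esum_(x in A) (p \- m)^\-%E x = \esum_(x in A) (Num.max (- J x) 0)%:E.
  by apply: eq_esum => x Ax; rewrite funenegE -JpmE// EFin_max.
have sJ := summableB sp sm.
have finof (q : R -> \bar R) : (forall x, 0 <= q x)%E -> summable A q -> \esum_(x in A) q x \is a fin_num.
  move=> q0; rewrite summableE; congr (_ \is a fin_num); apply: eq_esum => x _.
  by rewrite gee0_abs.
have fpos := finof _ (fun x => funepos_ge0 (p \- m)%E x) (summable_funepos sJ).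
have fneg := finof _ (fun x => funeneg_ge0 (p \- m)%E x) (summable_funeneg sJ).
rewrite posE negE pE mE => /(congr1 fine).
rewrite !fineB ?finp ?finm -?posE -?negE// => E.
rewrite /rsum -posE -negE E.
by under eq_fun do rewrite -big_mkcond/=.
Qed.

End Atoms.

(** * Contribution of the jump part to the integral *)

Section JumpEstimate.
Context {R : realType} {X : completeNormedModType R}.
Implicit Types (a b c d r w : R) (f v : R -> R) (chi : R -> X) (x xi : nat -> R).

(** Only the cell with [x i <= c < x i.+1] sees the step, and its tag is within [d] of [c]. For
    [c = b] no cell does, and the term in [chi b] makes up for it. *)
Lemma RS_sum_heaviside a b d w n x xi c chi : tagged_partition a b d n x xi ->
  0 <= w -> a <= c <= b ->
  (forall s t, a <= s <= b -> a <= t <= b -> `|s - t| <= d ->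
    `|chi s - chi t| <= w) ->
  `|RS_sum n x xi chi (fun th => (c < th)%R%:R) + (b <= c)%R%:R *: chi b - chi c| <= w.
Proof.
move=> P w0 /andP[ac cb] chiw; have [x0 xn xxi xd] := P.
have B := tagged_partition_bounds P; have Tag := tagged_partition_tag P.
have [bc|{}cb'] := leP b c.
  have -> : c = b by apply/eqP; rewrite eq_le cb.
  rewrite scale1r /RS_sum big1 ?add0r ?subrr ?normr0// => i _.
  have /andP[_ h1] := B i (ltnW (ltn_ord i)); have /andP[_ h2] := B i.+1 (ltn_ord i).
  by rewrite !ltNge h1 h2/= subrr scale0r.
have tele : \sum_(i < n) ((c < x i.+1)%R%:R - (c < x i)%R%:R : R) = 1.
  have := telescope_sumr (fun i => (c < x i)%R%:R : R) (leq0n n).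
  by rewrite big_mkord => ->; rewrite xn x0 cb' ltNge ac/= subr0.
have chicE : chi c = \sum_(i < n) ((c < x i.+1)%R%:R - (c < x i)%R%:R : R) *: chi c.
  by rewrite -scaler_suml tele scale1r.
rewrite scale0r addr0 [X in _ - X]chicE -sumrB.
rewrite (le_trans (ler_norm_sum _ _ _))// -[leRHS]mulr1 -[X in _ <= _ * X]tele mulr_sumr.
apply: ler_sum => i _; rewrite -scalerBr normrZ.
have /andP[h1 h2] := xxi _ (ltn_ord i); have hd := xd _ (ltn_ord i).
have [cx|xc] := ltP c (x i).
  by rewrite (lt_le_trans cx (le_trans h1 h2)) !subrr normr0 mul0r mulr0.
have [cx|_] := ltP c (x i.+1); last by rewrite subrr normr0 mul0r mulr0.
rewrite subr0 normr1 mul1r mulr1; apply: chiw; first exact: Tag.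
  by rewrite ac cb.
by rewrite ler_norml; lra.
Qed.

(** Summation by parts moves the differences onto [chi]; the left jump at [x i.+1] is at most the
    increase of [v] over the cell ending there. The boundary term at [a] vanishes since [f] has no
    left jump there. *)
Lemma RS_sum_left_jumps a b d w n f v chi : a < b -> (0 < n)%N ->
  let x := uniform_point a b n in
  (b - a) / n%:R <= d -> variation_bound v f ->
  (forall s t, a <= s <= b -> a <= t <= b -> `|s - t| <= d ->
    `|chi s - chi t| <= w) ->
  f a = llim f a ->
  `|RS_sum n x x chi (fun th => f th - llim f th) - (f b - llim f b) *: chi b|
    <= w * (v b - v a).
Proof.
move=> ab n0 x nd vf chiw fa; have vv := variation_bound_refl vf.
have P : tagged_partition a b d n x x by exact: uniform_partition (ltW ab) n0 nd.
have [x0 xn _ xd] := P.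
have B := tagged_partition_bounds P.
pose g th := f th - llim f th.
have ga : g a = 0 by rewrite /g fa subrr.
have -> : RS_sum n x x chi g = g b *: chi b -
    \sum_(i < n) g (x i.+1) *: (chi (x i.+1) - chi (x i)).
  have := telescope_sumr (fun i => g (x i) *: chi (x i)) (leq0n n).
  rewrite big_mkord xn x0 ga scale0r subr0 => <-.
  rewrite -sumrB; apply: eq_bigr => i _.
  by rewrite scalerBl scalerBr opprB [RHS]addrC addrA subrK.
rewrite addrAC subrr add0r normrN.
rewrite -x0 -xn -(telescope_sumr (fun i => v (x i)) (leq0n n)) big_mkord mulr_sumr.
rewrite (le_trans (ler_norm_sum _ _ _))//; apply: ler_sum => i _.
rewrite normrZ mulrC.
have xx : x i < x i.+1.
  rewrite /x /uniform_point ltrD2l ltr_pM2r ?ltr_nat//.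
  by rewrite divr_gt0 ?subr_gt0 ?ltr0n.
have := llim_dist_lt vv xx => /(le_trans (normr_ge0 _)) h1.
apply: ler_pM => //; last by rewrite (le_trans (llim_dist _ vf))//; lra.
apply: chiw; [exact: B|exact/B/ltnW|].
by rewrite ger0_norm ?subr_ge0 ?(ltW xx)// xd.
Qed.

(** The filter is arbitrary in order to serve both for partial sums over atoms and for [(s, phi)]
    tending to [(t, psi)]. *)
Lemma cvg_RS_sum {T : Type} {F : set_system T} {FF : Filter F} n x xi chi
    (g : T -> R -> R) f :
  (forall i, (i <= n)%N -> g q (x i) @[q --> F] --> f (x i)) ->
  RS_sum n x xi chi (g q) @[q --> F] --> RS_sum n x xi chi f.
Proof.
move=> gf; rewrite /RS_sum; apply: cvg_big => //.
  by apply: add_continuous.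
move=> i _; apply: cvgZr_tmp; apply: cvgB; apply: gf => //.
exact: ltnW.
Qed.

Lemma RS_sumD n x xi chi f g :
  RS_sum n x xi chi (f \+ g) = RS_sum n x xi chi f + RS_sum n x xi chi g.
Proof.
rewrite /RS_sum -big_split; apply: eq_bigr => i _ /=.
by rewrite -scalerDl; congr (_ *: _); ring.
Qed.

Lemma RS_sum_scale n x xi chi f c :
  RS_sum n x xi chi (fun th => c * f th) = c *: RS_sum n x xi chi f.
Proof.
rewrite /RS_sum scaler_sumr; apply: eq_bigr => i _ /=.
by rewrite scalerA mulrBr.
Qed.

Lemma RS_sum_sum n x xi chi (f : nat -> R -> R) m :
  RS_sum n x xi chi (fun th => \sum_(0 <= k < m) f k th) =
  \sum_(0 <= k < m) RS_sum n x xi chi (f k).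
Proof.
rewrite /RS_sum exchange_big/=; apply: eq_bigr => i _.
by rewrite -scaler_suml sumrB.
Qed.

(** Partition points stay in [[-r, 0]], so both integrators have the same sums; the extension is the
    one with a variation bound on the whole line. *)
Lemma RS_integral_extr r chi f : 0 <= r ->
  RS_integral (- r) 0 chi f = RS_integral (- r) 0 chi (extr r f).
Proof.
move=> r0; have key n x xi : x 0%N = - r -> x n = 0 ->
    (forall i, (i < n)%N -> x i <= xi i <= x i.+1) ->
    RS_sum n x xi chi f = RS_sum n x xi chi (extr r f).
  move=> x0 xn xxi.
  pose d := \sum_(i < n) (x i.+1 - x i).
  have P : tagged_partition (- r) 0 d n x xi.
    split=> // i ni; rewrite /d (bigD1 (Ordinal ni))//= lerDl sumr_ge0// => j _.
    by rewrite subr_ge0; have /andP[+ ] := xxi _ (ltn_ord j); exact: le_trans.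
  apply: eq_bigr => i _.
  by rewrite !extr_id// (tagged_partition_bounds P)// ltnW.
rewrite /RS_integral; congr (xget _ _).
apply/seteqP; split=> I /= + e e0 => /(_ e e0)[d d0 dI].
  by exists d => // n x xi x0 xn xxi xd; rewrite -key//; exact: dI.
by exists d => // n x xi x0 xn xxi xd; rewrite key//; exact: dI.
Qed.

(* The jump part only contributes through the sum over the atoms [c k]: each
   step function [th |-> (c k < th)] has Riemann-Stieltjes sum close to
   [chi (c k)], while the values at the jump points themselves are removed by a
   summation by parts. *)
Lemma RS_integral_decomposition r d w n f v chi (c h : nat -> R) (H V K tau : R) N :
  0 < r -> variation_bound v (extr r f) -> v 0 - v (- r) <= V ->
  unif_cont_on (- r) 0 chi -> 0 < d -> 0 <= w ->
  (forall s t, - r <= s <= 0 -> - r <= t <= 0 -> `|s - t| <= d ->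
    `|chi s - chi t| <= w) ->
  (forall s, - r <= s <= 0 -> `|chi s| <= K) ->
  (0 - - r) / n.+1%:R <= d / 2 ->
  (forall k, - r <= c k <= 0) ->
  (forall m, \sum_(0 <= k < m) `|h k| <= H) ->
  (forall m, \sum_(N <= k < m) `|h k| <= tau) ->
  (forall y, - r <= y <= 0 -> jump r (jump_part r f) y =
     limn (fun m => \sum_(0 <= k < m) (if c k == y then h k else 0))) ->
  `|RS_integral (- r) 0 chi f - (uniform_sum (- r) 0 n chi (cont_part r f) +
     \sum_(0 <= k < N) h k *: chi (c k))| <= w * (2 * V + H) + K * tau.
Proof.
move=> r0 vf vV uc d0 w0 chiw chiK nd cr hH htau Jh.
have r0' : - r <= 0 by rewrite oppr_le0 ltW.
have r0'' : - r < 0 by rewrite oppr_lt0.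
rewrite RS_integral_extr ?(ltW r0)//.
have h1 := RS_integral_uniform_sum r0' uc vf d0 w0 chiw nd.
set x := uniform_point (- r) 0 n.+1.
have nd' : (0 - - r) / n.+1%:R <= d by apply: le_trans nd _; lra.
have P : tagged_partition (- r) 0 d n.+1 x x by exact: uniform_partition.
have PB := tagged_partition_bounds P.
pose J := jump r f.
have {}Jh y : - r <= y <= 0 ->
    J y = limn (fun m => \sum_(0 <= k < m) (if c k == y then h k else 0)).
  by move=> ry; rewrite -Jh// (jump_jump_part r0 vf ry).
(* On [[-r, 0]] the jump part is [T + g]: the jumps strictly before the point and the left jump at
   the point. *)
pose T th := rsum [set y | - r <= y < th] J.
pose g th := extr r f th - llim (extr r f) th.
have fE : uniform_sum (- r) 0 n chi (extr r f) =
    uniform_sum (- r) 0 n chi (cont_part r f) +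
    (RS_sum n.+1 x x chi T + RS_sum n.+1 x x chi g).
  rewrite -RS_sumD -RS_sumD; apply: eq_bigr => i _; congr (_ *: _).
  rewrite !extr_id ?PB//; last exact: ltnW.
  by rewrite /= /cont_part /T /g -/(jump_part r f _) -/(jump_part r f _) !subrK.
have ga : extr r f (- r) = llim (extr r f) (- r).
  apply/esym/llim_eq; apply: cvg_near_cst; near=> s.
  have sr : s < - r by near: s; exact: nbhs_left_lt.
  by rewrite !extr_leN// ltW.
have gJ : g 0 = J 0.
  rewrite /g /J /jump; congr (_ - _); apply/esym/rlim_eq.
  apply: cvg_near_cst; near=> s.
  have s0 : 0 < s by near: s; exact: nbhs_right_gt.
  by rewrite !extr_ge0// ltW.
pose Z k := RS_sum n.+1 x x chi (fun th => (c k < th)%R%:R) + (0 <= c k)%R%:R *: chi 0.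
(* At each node the weighted steps of the atoms sum to [T], and the atoms at 0, which no step sees,
   sum to [J 0]. *)
have cvgZ : \sum_(0 <= k < m) h k *: Z k @[m --> \oo] -->
    RS_sum n.+1 x x chi T + J 0 *: chi 0.
  have -> : (fun m => \sum_(0 <= k < m) h k *: Z k) =
    (fun m => RS_sum n.+1 x x chi (fun th => \sum_(0 <= k < m) h k * (c k < th)%R%:R)
      + (\sum_(0 <= k < m) h k * (0 <= c k)%R%:R) *: chi 0).
    apply/funext => m; rewrite RS_sum_sum scaler_suml -big_split/=.
    by apply: eq_bigr => k _; rewrite RS_sum_scale -scalerA -scalerDr.
  apply: cvgD.
    apply: cvg_RS_sum => i ni.
    have /andP[_ xi0] := PB _ ni.
    have -> : (fun m => \sum_(0 <= k < m) h k * (c k < x i)%R%:R) = (fun m =>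
        \sum_(0 <= k < m) (if c k \in [set y | - r <= y < x i] then h k else 0)).
      apply/funext => m; apply: eq_bigr => k _.
      have -> : (c k \in [set y | - r <= y < x i]) = (c k < x i).
        by apply/idP/idP; rewrite inE/=; have /andP[-> _] := cr k.
      by case: ifP => _; rewrite ?mulr1 ?mulr0.
    apply: rsum_atoms hH _ => y /= /andP[ry yx]; apply: Jh; rewrite ry/=.
    exact: le_trans (ltW yx) xi0.
  apply: cvgZr_tmp; rewrite -(rsum_set1 J 0).
  have -> : (fun m => \sum_(0 <= k < m) h k * (0 <= c k)%R%:R) = (fun m =>
      \sum_(0 <= k < m) (if c k \in [set 0] then h k else 0)).
    apply/funext => m; apply: eq_bigr => k _.
    have -> : (c k \in [set 0]) = (0 <= c k).
      have /andP[_ ck0] := cr k; apply/idP/idP => [|ck].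
        by rewrite inE/= => ->.
      by rewrite inE/=; apply/eqP; rewrite eq_le ck0.
    by case: ifP => _; rewrite ?mulr1 ?mulr0.
  by apply: rsum_atoms hH _ => y /= ->; apply: Jh; rewrite r0' lexx.
have h3 : `|RS_sum n.+1 x x chi T + J 0 *: chi 0 -
    \sum_(0 <= k < N) h k *: chi (c k)| <= w * H + K * tau.
  have cz : `|\sum_(0 <= k < m) h k *: Z k - \sum_(0 <= k < N) h k *: chi (c k)|
      @[m --> \oo] --> `|RS_sum n.+1 x x chi T + J 0 *: chi 0 -
    \sum_(0 <= k < N) h k *: chi (c k)|.
    exact: cvg_norm (cvgB cvgZ (cvg_cst _)).
  apply: (cvgr_to_le cz); near=> m.
  have Nm : (N <= m)%N by near: m; exact: nbhs_infty_ge.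
  (* Replacing every [Z k] by [chi (c k)] costs at most [w * H]; dropping the atoms from [N] on
     costs at most [K * tau]. *)
  have -> : \sum_(0 <= k < m) h k *: Z k - \sum_(0 <= k < N) h k *: chi (c k) =
      \sum_(0 <= k < m) h k *: (Z k - chi (c k)) + \sum_(N <= k < m) h k *: chi (c k).
    under [X in _ = X + _]eq_bigr do rewrite scalerBr.
    rewrite sumrB [X in _ = _ - X + _](big_cat_nat (n := N))//=.
    by rewrite opprD -!addrA addNr addr0.
  rewrite (le_trans (ler_normD _ _))// lerD//.
    rewrite (le_trans (ler_norm_sum _ _ _))//.
    apply: (@le_trans _ _ (w * \sum_(0 <= k < m) `|h k|)); last by rewrite ler_wpM2l.
    rewrite mulr_sumr; apply: ler_sum => k _; rewrite normrZ mulrC ler_wpM2r//.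
    exact: RS_sum_heaviside P w0 (cr k) chiw.
  have K0 : 0 <= K by apply: le_trans (chiK 0 _); rewrite ?r0' ?lexx.
  rewrite (le_trans (ler_norm_sum _ _ _))//.
  apply: (@le_trans _ _ (K * \sum_(N <= k < m) `|h k|)); last by rewrite ler_wpM2l.
  by rewrite mulr_sumr; apply: ler_sum => k _; rewrite normrZ mulrC ler_wpM2r// chiK.
have h2 : `|RS_sum n.+1 x x chi g - J 0 *: chi 0| <= w * (v 0 - v (- r)).
  by rewrite -gJ; exact: RS_sum_left_jumps r0'' (ltn0Sn n) nd' vf chiw ga.
move: h1; rewrite fE => h1.
set I := RS_integral _ _ _ _ in h1 *; set Uc := uniform_sum _ _ _ _ _ in h1 *.
set S := \sum_(0 <= k < N) _ in h3 *.
set RT := RS_sum _ _ _ _ T in h1 h3 *; set RG := RS_sum _ _ _ _ g in h1 h2 *.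
(* The boundary terms [J 0 *: chi 0] cancel; the three errors are at most [w * V], [w * V] and
   [w * H + K * tau]. *)
have -> : I - (Uc + S) = (I - (Uc + (RT + RG))) + (RG - J 0 *: chi 0)
    + (RT + J 0 *: chi 0 - S).
  rewrite -[RHS]addrA.
  have -> : RG - J 0 *: chi 0 + (RT + J 0 *: chi 0 - S) = RT + RG - S.
    by rewrite addrACA !addrA addrK (addrC RG).
  by move: (RT + RG) => W; rewrite !opprD !addrA subrK.
rewrite (le_trans (ler_normD _ _))//.
have h4 := ler_normD (I - (Uc + (RT + RG))) (RG - J 0 *: chi 0).
have h5 : w * (v 0 - v (- r)) <= w * V by rewrite ler_wpM2l.
lra.
Unshelve. all: by end_near. Qed.

End JumpEstimate.

(** * Total variation as a variation bound *)

Section TotalVariation.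
Context {R : realType}.
Implicit Types (f : R -> R) (r s t : R).

Let clamp r t := Num.min 0 (Num.max (- r) t).

(** By additivity the increment of the variation function between the clamped points is the
    variation between them; finiteness carries additivity through [fine]. *)
Lemma total_variation_bound r f : 0 <= r -> bounded_variation (- r) 0 f ->
  variation_bound (extr r (fun t => fine (total_variation (- r) t f))) (extr r f).
Proof.
move=> r0 bvf s t st; rewrite /extr -/(clamp r s) -/(clamp r t).
have Nr0 : - r <= 0 by rewrite oppr_le0.
have cl u : - r <= clamp r u by rewrite le_min Nr0 le_max lexx.
have cu u : clamp r u <= 0 by rewrite ge_min lexx.
have cst : clamp r s <= clamp r t.
  by rewrite le_min !ge_min !ge_max !le_max !lexx st ?orbT.
move: (clamp r s) (clamp r t) (cl s) (cu t) cst => x y rx y0 xy {cl cu}.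
have ry := le_trans rx xy.
have bvy := bounded_variationl ry y0 bvf.
have bvx := bounded_variationl rx xy bvy; have bvxy := bounded_variationr rx xy bvy.
have /(bounded_variationP f rx) fx := bvx.
have /(bounded_variationP f xy) fxy := bvxy.
rewrite (total_variationD f rx xy) fineD// addrAC subrr add0r -lee_fin fineK//.
exact: total_variation_ge.
Qed.

End TotalVariation.

(** * The space C and convergence of pairs *)

Section FunctionSpace.
Context {R : realType} {X : normedModType R}.
Implicit Types (r t th : R) (phi psi : R -> X).

(** Heine-Cantor: the near-covering form of compactness, with the parameter [d] tending to 0 from
    the right. *)
Lemma inC_unif_cont r psi : inC r psi -> unif_cont_on (- r) 0 psi.
Proof.
move=> /subspace_continuousP psic w w0.
have w20 : 0 < w / 2 by rewrite divr_gt0.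
have /compact_near_coveringP/near_covering_withinP ncov := @segment_compact R (- r) 0.
have := ncov R 0^'+ (fun d s => forall t, - r <= t <= 0 -> `|s - t| <= d ->
  `|psi s - psi t| <= w) _.
move=> [|d /= d0 dP].
  move=> x xr; have /cvgrPdist_lt/(_ _ w20) := psic _ xr.
  rewrite near_withinE => /nbhs_ballP[e /= e0 eP].
  have e20 : 0 < e / 2 by rewrite divr_gt0.
  near=> s d => /= sr t tr st.
  have xs : `|x - s| < e / 2 by near: s; exact: nbhsx_ballx.
  have de : d < e / 2 by near: d; exact: nbhs_right_lt.
  have h1 : `|psi x - psi s| < w / 2.
    by apply: eP => //; rewrite -ball_normE/=; lra.
  have h2 : `|psi x - psi t| < w / 2.
    apply: eP; last by rewrite /= in_itv.
    by rewrite -ball_normE/= (le_lt_trans (ler_distD s _ _))//; lra.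
  rewrite (le_trans (ler_distD (psi x) _ _))// (distrC (psi s)); lra.
have d20 : 0 < d / 2 by rewrite divr_gt0.
exists (d / 2) => // s t sr tr st; apply: (dP (d / 2)) => //=.
  by rewrite sub0r normrN gtr0_norm//; lra.
Unshelve. all: by end_near. Qed.

Lemma inC_bounded r psi : inC r psi ->
  exists K : R, forall th, - r <= th <= 0 -> `|psi th| <= K.
Proof.
move=> psic.
have /compact_bounded[M [_ MP]] := continuous_compact psic (@segment_compact R (- r) 0).
exists (M + 1) => th thr; apply: (MP (M + 1)); first by rewrite ltrDl.
by exists th => //=; rewrite in_itv.
Qed.

(** Both functions are bounded on the compact segment, so [sup] is a true supremum and not a default
    value. *)
Lemma distC_ge r phi psi th : inC r phi -> inC r psi -> - r <= th <= 0 ->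
  `|phi th - psi th| <= distC r phi psi.
Proof.
move=> /inC_bounded[K phiK] /inC_bounded[L psiL] thr; apply: ub_le_sup.
  exists (K + L) => _ [t /= + <-]; rewrite in_itv/= => tr.
  by rewrite (le_trans (ler_normB _ _))// lerD ?phiK ?psiL.
by exists th => //=; rewrite in_itv.
Qed.

Lemma normC_le_distC r phi psi : 0 <= r -> inC r phi -> inC r psi ->
  normC r phi <= normC r psi + distC r phi psi.
Proof.
move=> r0 phic psic; apply: ge_sup.
  by exists `|phi 0|; exists 0 => //=; rewrite in_itv/= lexx oppr_le0 r0.
move=> _ [t /= + <-]; rewrite in_itv/= => tr.
have h1 := distC_ge phic psic tr.
have h2 : `|psi t| <= normC r psi.
  have [K psiK] := inC_bounded psic; apply: ub_le_sup.
    by exists K => _ [s /= + <-]; rewrite in_itv/= => sr; exact: psiK.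
  by exists t => //=; rewrite in_itv.
have := ler_normD (phi t - psi t) (psi t); rewrite subrK; lra.
Qed.

Lemma distCxx r psi : 0 <= r -> distC r psi psi = 0.
Proof.
move=> r0; rewrite /distC (_ : [set _ | _ in _] = [set 0]) ?sup1//.
apply/seteqP; split=> [_ [t _ <-]|_ ->]; first by rewrite /= subrr normr0.
by exists 0; rewrite ?subrr ?normr0//= in_itv/= lexx oppr_le0 r0.
Qed.

(** Elements of [C] are functions on the whole line that matter only on [[-r, 0]]; hence a filter
    generated by [distC]-balls, with membership in [C] built in. *)
Definition nbhsRC r t psi : set_system (R * (R -> X)) :=
  filter_from [set del : R | 0 < del] (fun del =>
    [set q | [/\ inC r q.2, `|q.1 - t| < del & distC r q.2 psi < del]]).

Global Instance nbhsRC_filter r t psi : Filter (nbhsRC r t psi).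
Proof.
apply: filter_from_filter; first by exists 1 => /=.
move=> d e /= d0 e0; exists (Num.min d e); first by rewrite /= lt_min d0.
by move=> q /= []; rewrite !lt_min => ? /andP[? ?] /andP[? ?].
Qed.

Lemma nbhsRC_inC r t psi : \forall q \near nbhsRC r t psi, inC r q.2.
Proof. by exists 1 => //= q []. Qed.

Lemma nbhsRC_dist r t psi del : 0 < del ->
  \forall q \near nbhsRC r t psi, `|q.1 - t| < del /\ distC r q.2 psi < del.
Proof. by exists del => // q []. Qed.

(** Makes an estimate valid near [(t, psi)] available at [(t, psi)] itself. *)
Lemma nbhsRC_self r t psi (P : set (R * (R -> X))) : 0 <= r -> inC r psi ->
  nbhsRC r t psi P -> P (t, psi).
Proof.
move=> r0 psic [del /= del0]; apply; split=> //=; first by rewrite subrr normr0.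
by rewrite distCxx.
Qed.

Lemma contRCP (V : normedModType R) r (f : R -> (R -> X) -> V) :
  contRC r f <-> forall t psi, inC r psi ->
    f q.1 q.2 @[q --> nbhsRC r t psi] --> f t psi.
Proof.
split=> fc t psi psic.
  apply/cvgrPdist_lt => e e0; have [del del0 dP] := fc t psi psic e e0.
  by exists del => // -[s phi] [/= phic st pp]; rewrite distrC; exact: dP.
move=> e e0; have /cvgrPdist_lt/(_ _ e0)[del del0 dP] := fc t psi psic.
by exists del => // s phi phic st pp; rewrite distrC; exact: (dP (s, phi)).
Qed.

End FunctionSpace.

(** * Uniform absolute summability of the jumps *)

Section UniformSummability.
Context {R : realType} {X : normedModType R}.
Implicit Types (r t : R) (psi : R -> X) (h : nat -> R -> (R -> X) -> R).

(** Cauchy form of the absolute convergence in (A3), uniform on bounded sets of pairs. *)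
Definition unif_summable r h := forall M eps : R, 0 < eps -> exists N : nat,
  forall m n : nat, (N <= m)%N -> forall t phi, inC r phi ->
    `|t| <= M -> normC r phi <= M -> \sum_(m <= k < n) `|h k t phi| < eps.

Lemma unif_summable_tail r h t psi eps : 0 <= r -> inC r psi ->
  unif_summable r h -> 0 < eps -> exists N : nat,
  \forall q \near nbhsRC r t psi,
    forall n, \sum_(N <= k < n) `|h k q.1 q.2| < eps.
Proof.
(* [M] bounds both components on the unit neighbourhood of [(t, psi)]. *)
move=> r0 psic hu e0; pose M := Num.max `|t| (normC r psi) + 1.
have [N NP] := hu M _ e0; exists N; near=> q => n.
have qc : inC r q.2 by near: q; exact: nbhsRC_inC.
have [qt qpsi] : `|q.1 - t| < 1 /\ distC r q.2 psi < 1.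
  by near: q; exact: nbhsRC_dist.
apply: NP => //.
  have := ler_normD (q.1 - t) t; rewrite subrK => /le_trans; apply.
  by rewrite /M addrC lerD ?(ltW qt)// le_max lexx.
rewrite (le_trans (normC_le_distC r0 qc psic))//.
by rewrite /M lerD ?(ltW qpsi)// le_max lexx orbT.
Unshelve. all: by end_near. Qed.

Lemma unif_summable_bounded r h t psi : 0 <= r -> inC r psi ->
  (forall k, contRC r (h k)) -> unif_summable r h ->
  exists2 H : R, 0 <= H & \forall q \near nbhsRC r t psi,
    forall n, \sum_(0 <= k < n) `|h k q.1 q.2| <= H.
Proof.
move=> r0 psic hc hu.
have [N NP] := unif_summable_tail t r0 psic hu ltr01.
pose H := \sum_(0 <= k < N) `|h k t psi|.
have H0 : 0 <= H by apply: sumr_ge0.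
(* One unit absorbs the change of the first [N] terms near [(t, psi)], the other bounds the tail. *)
exists (H + 1 + 1); first by rewrite !addr_ge0.
have cH : \sum_(0 <= k < N) `|h k q.1 q.2| @[q --> nbhsRC r t psi] --> H.
  apply: cvg_big; first exact: add_continuous.
  by move=> k _; apply: cvg_norm; have /contRCP := hc k; exact.
have H1 : H < H + 1 by rewrite ltrDl.
near=> q => n.
have qN : forall m, \sum_(N <= k < m) `|h k q.1 q.2| < 1 by near: q.
have qH : \sum_(0 <= k < N) `|h k q.1 q.2| <= H + 1.
  by near: q; exact: cvgr_le cH _ H1.
apply: le_trans (lerD qH (ltW (qN (maxn N n)))).
rewrite -big_cat_nat ?leq_maxl//= [leRHS](@big_cat_nat _ _ _ n) ?leq_maxr//=.
by rewrite lerDl sumr_ge0.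
Unshelve. all: by end_near. Qed.

End UniformSummability.

(** * Continuity of the delay functional and of [B] *)

Lemma lipschitz_unif_cont {R : realType} {X Y : normedModType R} (a b L : R)
    (q : X -> Y) (psi : R -> X) :
  0 <= L -> (forall u v, `|q u - q v| <= L * `|u - v|) ->
  unif_cont_on a b psi -> unif_cont_on a b (q \o psi).
Proof.
move=> L0 qL uc w w0; have L1 : 0 < L + 1 by rewrite ltr_wpDl.
have [d d0 dP] := uc _ (divr_gt0 w0 L1); exists d => // s t sab tab st.
rewrite (le_trans (qL _ _))//.
apply: (@le_trans _ _ ((L + 1) * (w / (L + 1)))).
  by apply: ler_pM => //; [rewrite lerDl|exact: dP].
by rewrite mulrC divfK// gt_eqF.
Qed.

Lemma Fdelay_continuous (R : realType) (X : completeNormedModType R) (r : R)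
  (p : R -> X -> X) (g : R -> R -> (R -> X) -> R)
  (eta h : nat -> R -> (R -> X) -> R) :
  0 < r ->
  (exists2 Lp : R, 0 <= Lp & forall t u s v,
      `|p t u - p s v| <= Lp * (`|s - t| + `|u - v|)) ->
  (exists C1 C2 : R, [/\ 0 <= C1, 0 <= C2 &
      forall s u, `|p s u| <= C1 * `|u| + C2]) ->
  (exists2 MVg : R, 0 < MVg & forall t phi, inC r phi ->
      bounded_variation (- r) 0 (fun th => g th t phi) /\
      (total_variation (- r) 0 (fun th => g th t phi) <= MVg%:E)%E) ->
  (forall th, - r <= th <= 0 ->
      contRC r (fun t phi => cont_part r (fun th' => g th' t phi) th)) ->
  (forall k, contRC r (eta k) /\ contRC r (h k)) ->
  (forall k t phi, inC r phi -> 0 <= eta k t phi <= r) ->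
  unif_summable r h ->
  (forall t phi, inC r phi -> forall x, - r <= x <= 0 ->
      jump r (jump_part r (fun th => g th t phi)) x =
      limn (fun n => \sum_(0 <= k < n) (if - eta k t phi == x then h k t phi else 0))) ->
  contRC r (Fdelay r p g).
Proof.
move=> r0 [L L0 pL] [C1 [C2 [C10 C20 pC]]] [V V0 gV] gc eh etar hu jh.
have r0' := ltW r0; have Nr0 : - r <= 0 by rewrite oppr_le0.
apply/contRCP => t psi psic; apply/cvgrPdist_lt => e e0.
have pLt u s v : `|p u s - p u v| <= L * `|s - v|.
  by rewrite (le_trans (pL _ _ _ _))// subrr normr0 add0r.
have pcont u phi : inC r phi -> unif_cont_on (- r) 0 (fun th => p u (phi th)).
  by move=> phic; apply: lipschitz_unif_cont L0 (pLt u) (inC_unif_cont phic).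
(* The integrand is frozen at [(t, psi)], so that at first only the integrator varies. *)
pose chi th := p t (psi th); have chic : unif_cont_on (- r) 0 chi by exact: pcont.
have [K K0 chiK] : exists2 K : R, 0 <= K & forall s, - r <= s <= 0 -> `|chi s| <= K.
  have [B psiB] := inC_bounded psic; exists (C1 * Num.max B 0 + C2).
    by rewrite addr_ge0// mulr_ge0// le_max lexx orbT.
  move=> s sr; rewrite (le_trans (pC _ _))// lerD2r ler_wpM2l//.
  by rewrite le_max psiB.
have vb u phi : inC r phi -> exists2 v, variation_bound v (extr r (g^~ u ^~ phi)) &
    v 0 - v (- r) <= V.
  move=> phic; have [bv tv] := gV u phi phic.
  exists (extr r (fun s => fine (total_variation (- r) s (g^~ u ^~ phi)))).
    exact: total_variation_bound.
  rewrite !extr_id ?lexx ?oppr_le0 ?r0'//.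
  rewrite total_variationxx subr0 -lee_fin fineK//.
  by apply/bounded_variationP => //; rewrite oppr_le0.
have [H H0 hH] := unif_summable_bounded t r0' psic (fun k => proj2 (eh k)) hu.
(* The oscillation [w] and the tail [tau] make the two error terms of the decomposition at most
   [e / 8] each. *)
have VH : 0 < 2 * V + H + 1 by rewrite ltr_wpDl// addr_ge0// mulr_ge0// ltW.
have w0 : 0 < e / 8 / (2 * V + H + 1) by rewrite !divr_gt0.
set w := e / 8 / _ in w0.
have wVH : w * (2 * V + H) <= e / 8.
  rewrite /w mulrAC ler_pdivrMr// ler_pM2l ?divr_gt0//; lra.
have [d d0 chiw] := chic _ w0.
have d20 : 0 < d / 2 by rewrite divr_gt0.
have [n _ /(_ n (leqnn n))/ltW nd] := uniform_mesh_lt (- r) 0 d20.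
have tau0 : 0 < e / 8 / (K + 1) by rewrite !divr_gt0// ltr_wpDl.
set tau := e / 8 / _ in tau0.
have Ktau : K * tau <= e / 8.
  rewrite /tau mulrA ler_pdivrMr ?ltr_wpDl// mulrC ler_pM2l ?divr_gt0//; lra.
have [N htau] := unif_summable_tail t r0' psic hu tau0.
(* The partition and the number [N] of atoms do not depend on [q], so continuity of [A] at
   [(t, psi)] concerns finitely many terms. *)
pose A (q : R * (R -> X)) :=
  uniform_sum (- r) 0 n chi (cont_part r (fun th => g th q.1 q.2)) +
  \sum_(0 <= k < N) h k q.1 q.2 *: chi (- eta k q.1 q.2).
have etaN k u phi : inC r phi -> - r <= - eta k u phi <= 0.
  by move=> phic; have /andP[h1 h2] := etar k u phi phic; apply/andP; split; lra.
have approx : \forall q \near nbhsRC r t psi,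
    `|RS_integral (- r) 0 chi (fun th => g th q.1 q.2) - A q| <= e / 4.
  near=> q.
  have qc : inC r q.2 by near: q; exact: nbhsRC_inC.
  have qH : forall m, \sum_(0 <= k < m) `|h k q.1 q.2| <= H by near: q.
  have qtau : forall m, \sum_(N <= k < m) `|h k q.1 q.2| < tau by near: q.
  have [v vq vV] := vb q.1 q.2 qc.
  have := RS_integral_decomposition r0 vq vV chic d0 (ltW w0) chiw chiK nd
    (fun k => etaN k q.1 q.2 qc) qH (fun m => ltW (qtau m)) (jh q.1 q.2 qc).
  by move=> /le_trans; apply; lra.
have cA : A q @[q --> nbhsRC r t psi] --> A (t, psi).
  apply: cvgD.
    apply: cvg_RS_sum => i ni.
    have P := uniform_partition Nr0 (ltn0Sn n) (lexx _).
    have xi := tagged_partition_bounds P ni.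
    by have /contRCP := gc _ xi; exact.
  apply: cvg_big; first exact: add_continuous.
  move=> k _; have [/contRCP etac /contRCP hc] := eh k.
  apply: cvgZ; first exact: hc.
  (* [chi] is controlled only on [[-r, 0]], where all the points [- eta k] lie. *)
  apply/cvgrPdist_le => a a0; have [b b0 bP] := chic _ a0.
  have /cvgrPdist_le/(_ _ b0) etab := etac t psi psic.
  near=> q; apply: bP.
  - exact: etaN.
  - by apply: etaN; near: q; exact: nbhsRC_inC.
  - by rewrite -opprD normrN; near: q.
have e40 : 0 < e / 4 by rewrite divr_gt0.
have e80 : 0 < e / 8 by rewrite divr_gt0.
have /cvgrPdist_lt/(_ _ e40) Ae := cA.
(* [del] will satisfy [del * 2 * LV = e / 8]; the 2 accounts for the shifts in time and in [C]. *)
pose LV := L * V + 1; have LV0 : 0 < LV by rewrite ltr_wpDl// mulr_ge0// ltW.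
have del0 : 0 < e / 8 / LV / 2 by rewrite !divr_gt0.
set del := e / 8 / LV / 2 in del0.
near=> q.
have qc : inC r q.2 by near: q; exact: nbhsRC_inC.
have [qt qpsi] : `|q.1 - t| < del /\ distC r q.2 psi < del.
  by near: q; exact: nbhsRC_dist.
have h1 : `|RS_integral (- r) 0 chi (fun th => g th q.1 q.2) - A q| <= e / 4.
  by near: q.
have h2 : `|Fdelay r p g t psi - A (t, psi)| <= e / 4.
  exact: (nbhsRC_self r0' psic approx).
have h3 : `|A (t, psi) - A q| < e / 4 by near: q.
have h4 : `|RS_integral (- r) 0 chi (fun th => g th q.1 q.2) -
    Fdelay r p g q.1 q.2| <= e / 8.
  have [v vq vV] := vb q.1 q.2 qc.
  rewrite /Fdelay (RS_integral_extr chi _ r0') [X in _ - X](RS_integral_extr _ _ r0').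
  have Ld0 : 0 <= L * (del * 2) by exact: mulr_ge0 L0 (mulr_ge0 (ltW del0) (ler0n R 2)).
  rewrite (le_trans (RS_integral_dist Nr0 chic (pcont q.1 q.2 qc) vq Ld0 _))//.
    move=> s sr; rewrite (le_trans (pL _ _ _ _))// ler_wpM2l//.
    have := distC_ge qc psic sr; rewrite (distrC (psi s)); lra.
  apply: (@le_trans _ _ (L * (del * 2) * V)); first by rewrite ler_wpM2l.
  have delE : del * 2 * LV = e / 8 
    by rewrite /del; field; rewrite gt_eqF.
  rewrite mulrAC -delE mulrC ler_wpM2l//; last by rewrite /LV lerDl.
  by rewrite mulr_ge0// ltW.
(* Three errors of at most [e / 4] and one of at most [e / 8] stay below [e]. *)
have t1 := ler_distD (A (t, psi)) (Fdelay r p g t psi) (Fdelay r p g q.1 q.2).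
have t2 := ler_distD (A q) (A (t, psi)) (Fdelay r p g q.1 q.2).
have t3 := ler_distD (RS_integral (- r) 0 chi (fun th => g th q.1 q.2)) (A q)
  (Fdelay r p g q.1 q.2).
rewrite distrC in h1; lra.
Unshelve. all: by end_near. Qed.

Theorem theorem1 (R : realType) (X : completeNormedModType R) (r : R)
  (G : R -> X -> X -> X) (p : R -> X -> X) (g : R -> R -> (R -> X) -> R)
  (eta h : nat -> R -> (R -> X) -> R) :
  0 < r ->
  (* G continuous on R x X x X *)
  continuous (fun z : R * X * X => G z.1.1 z.1.2 z.2) ->
  (* p Lipschitz *)
  (exists2 Lp : R, 0 <= Lp & forall t u s v,
      `|p t u - p s v| <= Lp * (`|s - t| + `|u - v|)) ->
  (* linear growth of p *)
  (exists C1 C2 : R, [/\ 0 <= C1, 0 <= C2 &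
      forall s u, `|p s u| <= C1 * `|u| + C2]) ->
  (* (A1) *)
  (exists2 MVg : R, 0 < MVg & forall t phi, inC r phi ->
      bounded_variation (- r) 0 (fun th => g th t phi) /\
      (total_variation (- r) 0 (fun th => g th t phi) <= MVg%:E)%E) ->
  (* (A2) *)
  (forall th, - r <= th <= 0 ->
      contRC r (fun t phi => cont_part r (fun th' => g th' t phi) th)) ->
  (* (A3) *)
  (forall k, contRC r (eta k) /\ contRC r (h k)) ->
  (forall k t phi, inC r phi -> 0 <= eta k t phi <= r) ->
  (forall M : R, forall eps : R, 0 < eps -> exists N : nat,
      forall m n : nat, (N <= m)%N -> forall t phi, inC r phi ->
        `|t| <= M -> normC r phi <= M ->
        \sum_(m <= k < n) `|h k t phi| < eps) ->
  (forall t phi, inC r phi -> forall x, - r <= x <= 0 ->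
      jump r (jump_part r (fun th => g th t phi)) x =
      limn (fun n => \sum_(0 <= k < n) (if - eta k t phi == x then h k t phi else 0))) ->
  contRC r (fun t psi => G t (psi 0) (Fdelay r p g t psi)).
Proof.
move=> r0 Gc pL pC gV gc eh etar hu jh; apply/contRCP => t psi psic.
have /contRCP Fc := Fdelay_continuous r0 pL pC gV gc eh etar hu jh.
have c1 : q.1 @[q --> nbhsRC r t psi] --> t.
  apply/cvgrPdist_lt => e e0; near=> q.
  have [qt _] : `|q.1 - t| < e /\ distC r q.2 psi < e.
    by near: q; exact: nbhsRC_dist.
  by rewrite distrC.
have c2 : q.2 0 @[q --> nbhsRC r t psi] --> psi 0.
  apply/cvgrPdist_lt => e e0; near=> q.
  have qc : inC r q.2 by near: q; exact: nbhsRC_inC.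
  have [_ qpsi] : `|q.1 - t| < e /\ distC r q.2 psi < e.
    by near: q; exact: nbhsRC_dist.
  rewrite distrC (le_lt_trans (distC_ge qc psic _))//.
  by rewrite lexx oppr_le0 ltW.
apply: (@cvg_comp _ _ _ (fun q : R * (R -> X) => (q.1, q.2 0, Fdelay r p g q.1 q.2))
  (fun z : R * X * X => G z.1.1 z.1.2 z.2) _
  (nbhs (t, psi 0, Fdelay r p g t psi)) _ _ (Gc _)).
exact: cvg_pair (cvg_pair c1 c2) (Fc t psi psic).
Unshelve. all: by end_near. Qed.
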